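(* Let $X=(X,\|\cdot\|)$ be a real normed linear space. For all nonzero vectors $x,y\in X$ we have $$\|x+y\|\leq\|x\|+\|y\|-\left(\frac{\|x\|}{\|y\|}+\frac{\|y\|}{\|x\|}-\left\|\frac{x}{\|y\|}+\frac{y}{\|x\|}\right\|\right)\min\{\|x\|,\|y\|\}$$ and $$\|x+y\|\geq\|x\|+\|y\|-\left(\frac{\|x\|}{\|y\|}+\frac{\|y\|}{\|x\|}-\left\|\frac{x}{\|y\|}+\frac{y}{\|x\|}\right\|\right)\max\{\|x\|,\|y\|\}.$$ *)

(* Defs.v *)
From mathcomp Require Export all_boot all_order all_algebra.
From mathcomp Require Export reals normedtype.

(* Main.v *)
Require Import Defs.
From mathcomp Require Import ring.
Import Order.TTheory GRing.Theory Num.Theory.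
Import numFieldNormedType.Exports.
Local Open Scope ring_scope.

(* Write z for x / |y| + y / |x|. Both inequalities are the triangle inequality, for
   x + y = |x| z + (1 - |x| / |y|) x and |y| z = (x + y) + (|y| / |x| - 1) y,
   whose scalar coefficients are nonnegative when |x| <= |y|. *)
Lemma norm_add_bounds_le (R : numFieldType) (X : normedModType R) (x y : X)
    (hx : x != 0) (hy : y != 0) (le_xy : `|x| <= `|y|) :
  let d := `|x| / `|y| + `|y| / `|x| - `| `|y|^-1 *: x + `|x|^-1 *: y | in
  `|x + y| <= `|x| + `|y| - d * `|x| /\ `|x| + `|y| - d * `|y| <= `|x + y|.
Proof.
set z := `|y|^-1 *: x + `|x|^-1 *: y => d.
have x0 : 0 < `|x| by rewrite normr_gt0.
have y0 : 0 < `|y| by rewrite normr_gt0.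
have xn0 := lt0r_neq0 x0; have yn0 := lt0r_neq0 y0.
split.
- have -> : x + y = `|x| *: z + (1 - `|x| / `|y|) *: x.
    rewrite scalerDr !scalerA divff // scale1r addrAC -scalerDl.
    by rewrite addrC addrCA subrr addr0 scale1r addrC.
  apply: (le_trans (ler_normD _ _)).
  (* By [le_xy] the coefficient of [x] is its own norm; the resulting bound is then exactly the
     claimed one, so only a field identity remains. *)
  rewrite !normrZ normr_id ger0_norm ?subr_ge0 ?ler_pdivrMr ?mul1r //.
  by rewrite le_eqVlt; apply/orP; left; apply/eqP; rewrite /d; field; apply/andP.
- have zE : `|y| *: z = (x + y) + (`|y| / `|x| - 1) *: y.
    rewrite scalerDr !scalerA divff // scale1r scalerBl scale1r.
    by rewrite -addrA [y + _]addrC subrK.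
  have := ler_normD (x + y) ((`|y| / `|x| - 1) *: y).
  rewrite -zE !normrZ normr_id ger0_norm ?subr_ge0 ?ler_pdivlMr ?mul1r //.
  (* Moving the [y] term across isolates [|x + y|]; what bounds it from below equals the claimed
     left side. *)
  rewrite -lerBlDr; apply: le_trans.
  by rewrite le_eqVlt; apply/orP; left; apply/eqP; rewrite /d; field; apply/andP.
Qed.

Theorem theorem2p1 (R : realType) (X : normedModType R) (x y : X)
    (hx : x != 0) (hy : y != 0) :
  `|x + y| <= `|x| + `|y|
    - (`|x| / `|y| + `|y| / `|x| - `| `|y|^-1 *: x + `|x|^-1 *: y |)
      * Num.min `|x| `|y|
  /\
  `|x + y| >= `|x| + `|y|
    - (`|x| / `|y| + `|y| / `|x| - `| `|y|^-1 *: x + `|x|^-1 *: y |)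
      * Num.max `|x| `|y|.
Proof.
(* The case split also evaluates the minimum and the maximum. *)
case: (leP `|x| `|y|) => [le_xy|/ltW le_yx].
  exact: norm_add_bounds_le.
(* The claim is symmetric in [x] and [y]: commuting the four sums exchanges their roles. *)
rewrite [x + y]addrC [`|x| + `|y|]addrC [`|x| / _ + _]addrC.
rewrite [`|y|^-1 *: x + _]addrC.
exact: norm_add_bounds_le.
Qed.
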